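(* Let $(G,u)$ be an Archimedean norm-complete dimension group with order-unit. Let $S$ be the state space of $(G,u)$ and let $\phi\colon G\to\mathrm{Aff}(S)$ be the natural map. Let $p\colon S\to\mathbb{R}\cup\{-\infty\}$ be convex upper semicontinuous and let $q\colon S\to\mathbb{R}\cup\{+\infty\}$ be concave lower semicontinuous such that $p\leq q$ and, for every discrete extremal state $s\in\partial_{\mathrm{e}}S$, $\{p(s),q(s)\}\subseteq s[G]\cup\{-\infty,+\infty\}$. Then there exists $x\in G$ such that $p\leq\phi(x)\leq q$.
   Context: A partially ordered abelian group is an abelian group $G$ with a translation-invariant partial order; $G^+=\{x\in G: x\ge0\}$; $\mathbb{N}$ is the set of positive integers. An order-unit is $u\in G^+$ such that for every $x\in G$ there is $n\in\mathbb{N}$ with $x\leq nu$. $G$ is directed if any two elements have a common upper bound; unperforated if for all $m\in\mathbb{N}$ and $x\in G$, $mx\geq0$ implies $x\geq0$; $G$ has interpolation if whenever $a_0,a_1\leq b_0,b_1$ there is $c$ with $a_0,a_1\leq c\leq b_0,b_1$. A dimension group is a directed unperforated partially ordered abelian group with interpolation. $G$ is Archimedean if for all $a,b\in G$, ($na\leq b$ for all integers $n\geq0$) implies $a\leq0$. The canonical norm on $(G,u)$ is $\|x\|_u=\inf\{k/n: k\in\mathbb{Z},\,k\ge0,\ n\in\mathbb{N},\ -ku\leq nx\leq ku\}$; $(G,u)$ is norm-complete if every Cauchy sequence for $\|\cdot\|_u$ converges in $G$. The state space $S$ of $(G,u)$ is the set of all positive (order-preserving) group homomorphisms $s\colon G\to\mathbb{R}$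 with $s(u)=1$ (states), a compact convex subset of $\mathbb{R}^G$ (product topology). $\partial_{\mathrm{e}}S$ is the set of its extreme points (extremal states). A state $s$ is discrete if $s[G]=\{s(x):x\in G\}$ is a discrete subgroup of $\mathbb{R}$. $\mathrm{Aff}(S)$ is the partially ordered (pointwise) group of affine continuous functions $S\to\mathbb{R}$, and $\phi(x)(s)=s(x)$. Inequalities between functions are pointwise. *)

(* Defs.v *)
From HB Require Import structures.
From mathcomp Require Import all_boot all_order all_algebra.
From mathcomp Require Import all_classical all_reals all_analysis.

Set Implicit Arguments.
Unset Strict Implicit.
Unset Printing Implicit Defensive.

Import Order.TTheory GRing.Theory Num.Theory.
Import numFieldNormedType.Exports.

Local Open Scope classical_set_scope.
Local Open Scope ring_scope.
Local Open Scope convex_scope.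

(* [porderZmodType] only joins an order and an additive group, without any
   compatibility axiom. *)
HB.mixin Record isPOGroup G & Num.POrderedZmodule G := {
  lerD2r_pogroup : forall z x y : G, x <= y -> x + z <= y + z
}.

#[short(type="poGroupType")]
HB.structure Definition POGroup :=
  {G of Num.POrderedZmodule G & isPOGroup G}.

Section POGroupDefs.
Variable G : poGroupType.

Definition order_unit (u : G) : Prop :=
  0 <= u /\ forall x : G, exists2 n : nat, (0 < n)%N & x <= u *+ n.

Definition directed : Prop :=
  forall x y : G, exists z : G, x <= z /\ y <= z.

Definition unperforated : Prop :=
  forall (m : nat) (x : G), (0 < m)%N -> 0 <= x *+ m -> 0 <= x.

Definition interpolation : Prop :=
  forall a0 a1 b0 b1 : G,
    a0 <= b0 -> a0 <= b1 -> a1 <= b0 -> a1 <= b1 ->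
    exists c : G, [/\ a0 <= c, a1 <= c, c <= b0 & c <= b1].

Definition dimension_group : Prop :=
  [/\ directed, unperforated & interpolation].

Definition archimedean_group : Prop :=
  forall a b : G, (forall n : nat, a *+ n <= b) -> a <= 0.

End POGroupDefs.

Section UnitNorm.
Variables (R : realType) (G : poGroupType) (u : G).

Definition unorm (x : G) : R :=
  inf [set r : R | exists k n : nat,
    [/\ (0 < n)%N, - (u *+ k) <= x *+ n, x *+ n <= u *+ k & r = k%:R / n%:R]].

Definition unorm_cauchy (f : nat -> G) : Prop :=
  forall e : R, 0 < e ->
    exists N : nat, forall m n : nat, (N <= m)%N -> (N <= n)%N ->
      unorm (f m - f n) < e.

Definition unorm_converges (f : nat -> G) (x : G) : Prop :=
  forall e : R, 0 < e ->
    exists N : nat, forall n : nat, (N <= n)%N -> unorm (f n - x) < e.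

Definition norm_complete : Prop :=
  forall f : nat -> G, unorm_cauchy f -> exists x : G, unorm_converges f x.

End UnitNorm.

Section ConvexNotions.
Variables (R : realType) (S : convType R).

(* With [0 * -oo = 0 * +oo = 0], the endpoints of the segment impose no
   condition; [-oo + +oo] does not arise for functions that avoid one of the
   two infinities. *)
Definition convex_efun (f : S -> \bar R) : Prop :=
  forall (t : {i01 R}) (a b : S),
    (f (a <| t |> b) <= t%:num%:E * f a + (1 - t%:num)%:E * f b)%E.

Definition concave_efun (f : S -> \bar R) : Prop :=
  forall (t : {i01 R}) (a b : S),
    (t%:num%:E * f a + (1 - t%:num)%:E * f b <= f (a <| t |> b))%E.

Definition affine_fun (f : S -> R) : Prop :=
  forall (t : {i01 R}) (a b : S),
    f (a <| t |> b) = t%:num * f a + (1 - t%:num) * f b.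

Definition extreme_point (s : S) : Prop :=
  forall (t : {i01 R}) (a b : S), 0 < t%:num -> t%:num < 1 ->
    s = a <| t |> b -> a = s /\ b = s.

End ConvexNotions.

(* Mirrors [lower_semicontinuous]. *)
Definition upper_semicontinuous (R : realType) (X : topologicalType)
    (f : X -> \bar R) : Prop :=
  forall x a, (f x < a%:E)%E ->
    exists2 V, nbhs x V & forall y, V y -> (f y < a%:E)%E.

Definition is_state (R : realType) (G : poGroupType) (u : G) :
    set {ptws G -> R} :=
  [set s | [/\ {morph s : x y / x + y},
               {homo s : x y / x <= y} & s u = 1]].

(* The state space, with the subspace topology of the product topology. *)
Definition states (R : realType) (G : poGroupType) (u : G) : Type :=
  is_state (R := R) u.

HB.instance Definition _ (R : realType) (G : poGroupType) (u : G) :=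
  Topological.copy (states R u) (set_type (is_state (R := R) u)).

Definition state_fun (R : realType) (G : poGroupType) (u : G)
  (s : states R u) : G -> R := \val s.
Coercion state_fun : states >-> Funclass.

Section StateConvexity.
Variables (R : realType) (G : poGroupType) (u : G).
Implicit Types (s : states R u) (t : {i01 R}).

Lemma stateP s : is_state u (s : G -> R).
Proof. exact: set_mem (valP s). Qed.

Lemma state_ext s s' : (forall x, s x = s' x) -> s = s'.
Proof. by move=> e; apply/val_inj/funext. Qed.

Lemma is_state_conv t s s' :
  is_state u (fun x => t%:num * s x + (1 - t%:num) * s' x).
Proof.
have [sD sle s1] := stateP s; have [s'D s'le s'1] := stateP s'.
have t1 : 0 <= 1 - t%:num by rewrite subr_ge0.
split=> [x y|x y xy|] /=.
- by rewrite sD s'D !mulrDr addrACA.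
- by rewrite lerD// ler_wpM2l// ?sle ?s'le.
- by rewrite s1 s'1 !mulr1 addrC subrK.
Qed.

Definition state_conv t s s' : states R u :=
  exist _ (fun x => t%:num * s x + (1 - t%:num) * s' x)
    (mem_set (is_state_conv t s s')).

Lemma state_conv1 s s' : state_conv 1%:i01 s s' = s.
Proof. by apply: state_ext => x /=; rewrite /state_fun/= subrr mul1r mul0r addr0. Qed.

Lemma state_convmm t s : state_conv t s s = s.
Proof.
by apply: state_ext => x; rewrite /state_fun/= -mulrDl addrC subrK mul1r.
Qed.

Lemma state_convC t s s' :
  state_conv t s s' = state_conv (1 - t%:inum)%:i01 s' s.
Proof.
by apply: state_ext => x; rewrite /state_fun/= subKr addrC.
Qed.

Lemma state_convA : convex_quasi_associative state_conv.
Proof.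
move=> p q r s a b c prs spq; apply: state_ext => x; rewrite /state_fun/=.
have := @convA R (convex_lmodType R^o) p q r s (a x) (b x) (c x) prs spq.
by [].
Qed.

HB.instance Definition _ :=
  isConvexSpace.Build R (states R u)
    state_conv1 state_convmm state_convC state_convA.

End StateConvexity.

Record Aff (R : realType) (G : poGroupType) (u : G) := MkAff {
  aff_fun :> states R u -> R ;
  aff_affine : affine_fun aff_fun ;
  aff_continuous : continuous aff_fun
}.

Section NaturalMap.
Variables (R : realType) (G : poGroupType) (u : G).

Lemma eval_affine (x : G) : affine_fun (fun s : states R u => s x).
Proof. by []. Qed.

Lemma eval_continuous (x : G) : continuous (fun s : states R u => s x).
Proof.
move=> s; apply: (@continuous_comp (states R u) {ptws G -> R} R
  (fun s => \val s) (fun f => f x)).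
  exact: (@initial_continuous _ {ptws G -> R}).
exact: (@proj_continuous _ (fun _ : G => R)).
Qed.

Definition phi (x : G) : Aff R u :=
  MkAff (eval_affine x) (@eval_continuous x).

End NaturalMap.

Definition discrete_state (R : realType) (G : poGroupType) (u : G)
    (s : states R u) : Prop :=
  forall r : R, range s r -> isolated (range s) r.

(* Main.v *)
Require Import Defs.
From mathcomp Require Import all_boot all_order all_algebra.
From mathcomp Require Import all_classical all_reals all_analysis.
From mathcomp Require Import lra.

(** The sandwich theorem is reduced to extremal states, where it holds by
    hypothesis, by two applications of a Bauer-type maximum principle.

    Replace [q] by [r = - q], so that [p] and [r] are both convex and upper
    semicontinuous and the element sought satisfies [p <= x] and [r <= - x].
    On the compact convex set of states, a convex upper semicontinuous function
    attains its maximum at an extreme point ([bauer_maximum]). If a set [H] of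
    elements of [G] is upward directed and bounded above, its pointwise
    supremum is affine, so the principle applies to [p - sup H]: if at every
    extremal state some element of [H] lies strictly above [p], then, by
    directedness and compactness, a single element of [H] lies strictly above
    [p] at all states ([directed_above]).

    Interpolation enters through the extremal states: for such an [s], every
    [x] has majorants [d >= 0] with [s d] as close as desired to [max(0, s x)]
    ([extreme_inf]). The infimum of these values is a sublinear function of
    [x], a Hahn-Banach argument finds an additive map below it which attains it
    at [x], and that map lies between [0] and [s], hence is a multiple of [s].

    The strict version of the theorem ([strict_sandwich]) follows. Let [F] be
    the set of all [a] strictly above [p]. By [directed_above], applied to the
    common lower bounds of two members, [F] is downward directed
    ([majorants_directed]). At an extremal state [s0] members of [F] come as
    close as desired to any value [s0 x > p s0]: add to [x] a positive element
    that is tiny at [s0] and large on the closed set where [p >= x]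
    ([extreme_peak]). So [directed_above], applied to [- F] and [r], gives an
    [a] in [F] that is strictly below [- r].

    The discreteness condition supplies the pointwise hypothesis of the strict
    version: enlarge [p] and [r] by a margin [e]; at a nondiscrete extremal
    state the values [s x] are dense, at a discrete one a suitable value is
    given ([approximate_sandwich]). Finally, an approximate solution [x] for
    the margin [e] is improved to one for [e / 2] that stays within [2 e] of
    [x], by approximating between [max(p, x - e)] and [min(q, x + e)]; the
    condition at discrete extremal states survives because one of [s x], [p s],
    [q s] lies between the new bounds ([refine_sandwich]). The successive
    solutions form a Cauchy sequence, and its limit is the solution. *)

Set Implicit Arguments.
Unset Strict Implicit.
Unset Printing Implicit Defensive.

Import Order.TTheory GRing.Theory Num.Theory.
Import numFieldNormedType.Exports.

Local Open Scope classical_set_scope.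
Local Open Scope ring_scope.
Local Open Scope convex_scope.

(** * A Hahn-Banach theorem for abelian groups *)

Section AdditiveMaps.
Variables (R : realType) (G : zmodType) (f : G -> R).
Hypothesis fD : {morph f : x y / x + y}.

Lemma additive0 : f 0 = 0.
Proof. by have := fD 0 0; rewrite addr0; lra. Qed.

Lemma additiveN : {morph f : x / - x}.
Proof. by move=> x; have := fD x (- x); rewrite subrr additive0; lra. Qed.

Lemma additiveMn n : {morph f : x / x *+ n}.
Proof.
by move=> x; elim: n => [|n IH]; rewrite ?mulr0n ?additive0// !mulrS fD IH.
Qed.

End AdditiveMaps.

Section HahnBanach.
Variables (R : realType) (G : zmodType).
Implicit Types f g t : G -> R.

(** Over a group, homogeneity can only be asked for natural multiples; on an
    abelian group that is enough for the Hahn-Banach argument. *)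
Definition sublinear f :=
  (forall x y, f (x + y) <= f x + f y) /\ (forall n x, f (x *+ n) = f x *+ n).

Lemma sublinear0 f : sublinear f -> f 0 = 0.
Proof. by case=> _ /(_ 0%N 0); rewrite !mulr0n. Qed.

Lemma sublinear_opp f x : sublinear f -> - f (- x) <= f x.
Proof.
move=> sf; have [fD _] := sf.
by have := fD x (- x); rewrite subrr sublinear0//; lra.
Qed.

(** The reduction step of Hahn-Banach: the new function is the infimum over [n]
    of [f (x + n y) - n f y], a sequence that decreases with [n]. The value at
    [- y] becomes as small as sublinearity permits, so [f] can be minimal only
    if it is odd. *)
Lemma sublinear_shift f y : sublinear f ->
  exists g, [/\ sublinear g, forall x, g x <= f x & g (- y) <= - f y].
Proof.
move=> sf; have [fD fM] := sf.
pose v x n := f (x + y *+ n) - f y *+ n.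
pose A x := [set v x n | n in [set: nat]].
pose g x := inf (A x).
have A0 x : A x !=set0 by exists (v x 0%N); exists 0%N.
have Alb x : lbound (A x) (- f (- x)).
  move=> _ [n _ <-]; rewrite /v -fM.
  have := fD (- x) (x + y *+ n); rewrite addKr; lra.
have gle x n : g x <= v x n by apply: ge_inf; [exists (- f (- x))|exists n].
have leg x c : (forall n, c <= v x n) -> c <= g x.
  by move=> cv; apply: lb_le_inf => // _ [n _ <-].
have vD x1 x2 n m : v (x1 + x2) (n + m)%N <= v x1 n + v x2 m.
  rewrite /v !mulrnDr.
  have := fD (x1 + y *+ n) (x2 + y *+ m); rewrite addrACA; lra.
exists g; split; last 2 first.
- by move=> x; apply: le_trans (gle x 0%N) _; rewrite /v !mulr0n addr0 subr0.
- apply: le_trans (gle _ 1%N) _.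
  by rewrite /v !mulr1n addNr sublinear0// sub0r.
split=> [x1 x2|m x].
  rewrite -lerBlDr; apply: (leg) => n; rewrite lerBlDr -lerBlDl.
  by apply: (leg) => k; rewrite lerBlDl; apply: le_trans (gle _ _) (vD _ _ _ _).
have vM n : v (x *+ m) (n * m)%N = v x n *+ m.
  by rewrite /v mulrnA -mulrnDl fM mulrnBl mulrnA.
have [->|m0] := posnP m.
  rewrite !mulr0n; apply/eqP; rewrite eq_le; apply/andP; split.
    by apply: le_trans (gle 0 0%N) _; rewrite /v !mulr0n addr0 sublinear0// subrr.
  by apply: (leg) => n; rewrite /v add0r fM subrr.
apply/eqP; rewrite eq_le; apply/andP; split.
  rewrite -[leRHS]mulr_natl -ler_pdivrMl ?ltr0n//.
  apply: (leg) => n; rewrite ler_pdivrMl ?ltr0n// mulr_natl -vM.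
  exact: gle.
apply: (leg) => n; apply: le_trans (_ : v x n *+ m <= _).
  by rewrite ler_wMn2r.
have e : v (x *+ m) (n * m)%N <= v (x *+ m) n.
  rewrite /v; have -> : (n * m = n + n * m.-1)%N by rewrite -mulnS prednK.
  have := fD (x *+ m + y *+ n) (y *+ (n * m.-1)%N).
  rewrite !mulrnDr addrA fM; lra.
by rewrite -vM.
Qed.

(** Zorn: along a chain of sublinear functions the pointwise infimum is again
    sublinear, and it is finite because [- f (- x)] bounds the chain below. *)
Lemma minimal_sublinear f : sublinear f -> exists t,
  [/\ sublinear t, forall x, t x <= f x &
      forall g, sublinear g -> (forall x, g x <= t x) -> g = t].
Proof.
move=> sf.
pose T := {g : G -> R | sublinear g /\ forall x, g x <= f x}.
pose below (g h : T) := `[< forall x, sval h x <= sval g x >].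
have [] := @Zorn T below.
- by move=> g; apply/asboolP.
- move=> g h k /asboolP gh /asboolP hk; apply/asboolP => x.
  exact: le_trans (hk x) (gh x).
- move=> [g pg] [h ph] /asboolP gh /asboolP hg; apply: eq_exist => /=.
  by apply/funext => x; apply/eqP; rewrite eq_le gh hg.
- move=> A totA.
  have [->|/set0P[g0 Ag0]] := eqVneq A set0.
    by exists (exist _ f (conj sf (fun x => lexx (f x)))).
  pose V x := [set sval g x | g in A].
  pose h x := inf (V x).
  have V0 x : V x !=set0 by exists (sval g0 x); exists g0.
  have lbV x : lbound (V x) (- f (- x)).
    move=> _ [[g [sg gf]] Ag <-] /=.
    by apply: le_trans (sublinear_opp x sg); rewrite lerN2.
  have hle (g : T) x : A g -> h x <= sval g x.
    by move=> Ag; apply: ge_inf; [exists (- f (- x))|exists g].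
  have leh x c : (forall g : T, A g -> c <= sval g x) -> c <= h x.
    by move=> cg; apply: lb_le_inf => // _ [g Ag <-]; exact: cg.
  have hP : sublinear h /\ forall x, h x <= f x.
    split; last by move=> x; apply: le_trans (hle _ _ Ag0) ((svalP g0).2 x).
    split=> [x y|n x].
      rewrite -lerBlDr; apply: (leh) => g Ag; rewrite lerBlDr -lerBlDl.
      apply: (leh) => k Ak; rewrite lerBlDl.
      have [/asboolP gk|/asboolP kg] := totA _ _ Ag Ak.
        apply: le_trans (hle _ _ Ak) _.
        apply: le_trans ((svalP k).1.1 x y) _.
        by rewrite lerD2r.
      apply: le_trans (hle _ _ Ag) _.
      apply: le_trans ((svalP g).1.1 x y) _.
      by rewrite lerD2l.
    have [->|n0] := posnP n.
      rewrite !mulr0n; apply/eqP; rewrite eq_le; apply/andP; split.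
        by apply: le_trans (hle _ _ Ag0) _; rewrite sublinear0//; case: (svalP g0).
      by apply: (leh) => g _; rewrite sublinear0//; case: (svalP g).
    apply/eqP; rewrite eq_le; apply/andP; split.
      rewrite -[leRHS]mulr_natl -ler_pdivrMl ?ltr0n//.
      apply: (leh) => g Ag; rewrite ler_pdivrMl ?ltr0n// mulr_natl.
      by rewrite -(svalP g).1.2; exact: hle.
    apply: (leh) => g Ag; rewrite (svalP g).1.2.
    by rewrite ler_wMn2r// hle.
  by exists (exist _ h hP) => g Ag; apply/asboolP => x /=; exact: hle.
move=> [t [st tf]] tmin; exists t; split=> // g sg gt.
have gP : sublinear g /\ forall x, g x <= f x.
  by split=> // x; exact: le_trans (gt x) (tf x).
by have /(congr1 sval) := tmin (exist _ g gP) (introT (asboolP _) gt).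
Qed.

(** A minimal sublinear function is odd by the reduction step, hence additive.
    Shifting once at [x0] before minimizing forces the value at [x0]. *)
Lemma hahn_banach_zmod f x0 : sublinear f -> exists t : G -> R,
  [/\ {morph t : x y / x + y}, forall x, t x <= f x & t x0 = f x0].
Proof.
move=> sf.
have [f1 [sf1 f1f f1x0]] := sublinear_shift x0 sf.
have [t [st tf1 tmin]] := minimal_sublinear sf1.
have [tD tM] := st.
have tN y : t (- y) = - t y.
  apply/eqP; rewrite eq_le; apply/andP; split.
    by have [g [sg gt]] := sublinear_shift y st; rewrite (tmin g sg gt).
  by have := sublinear_opp (- y) st; rewrite opprK.
have tle x : t x <= f x by exact: le_trans (tf1 x) (f1f x).
exists t; split=> //.
  move=> x y; apply/eqP; rewrite eq_le tD /=.
  by have := tD (x + y) (- y); rewrite addrK tN; lra.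
apply/eqP; rewrite eq_le tle /= -lerN2 -tN.
exact: le_trans (tf1 _) f1x0.
Qed.

End HahnBanach.

(** * Partially ordered groups and their states *)

Section POGroupTheory.
Variable G : poGroupType.
Implicit Types x y z d e : G.

Lemma po_lerD x y z e : x <= y -> z <= e -> x + z <= y + e.
Proof.
move=> xy ze; apply: le_trans (lerD2r_pogroup z _ _ xy) _.
by rewrite ![y + _]addrC; exact: lerD2r_pogroup.
Qed.

Lemma po_lerBrDr x y z : (x <= y - z) = (x + z <= y).
Proof.
apply/idP/idP => h; first by have := lerD2r_pogroup z _ _ h; rewrite subrK.
by have := lerD2r_pogroup (- z) _ _ h; rewrite addrK.
Qed.

Lemma po_subr_ge0 x y : (0 <= y - x) = (x <= y).
Proof. by rewrite po_lerBrDr add0r. Qed.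

Lemma po_lerN2 x y : (- x <= - y) = (y <= x).
Proof. by rewrite -(po_subr_ge0 (- x)) opprK addrC po_subr_ge0. Qed.

Lemma po_lerMn2r x y n : x <= y -> x *+ n <= y *+ n.
Proof. by move=> xy; elim: n => [|n IH]; rewrite ?mulr0n// !mulrS po_lerD. Qed.

Lemma po_mulrn_ge0 x n : 0 <= x -> 0 <= x *+ n.
Proof. by move=> /(po_lerMn2r n); rewrite mul0rn. Qed.

Lemma unperforated_le x y n :
  unperforated G -> (0 < n)%N -> x *+ n <= y *+ n -> x <= y.
Proof.
move=> unp n0; rewrite -(po_subr_ge0 (x *+ n)) -mulrnBl => /(unp _ _ n0).
by rewrite po_subr_ge0.
Qed.

(** In a lattice-ordered group [e] would be the positive part of [x].
    Interpolation splits [d] into [n] parts, each above [0] and [x], and then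
    finds [e] below all of these parts. *)
Lemma riesz_root n x d : unperforated G -> interpolation G -> (0 < n)%N ->
  0 <= d -> x *+ n <= d -> exists e, [/\ 0 <= e, x <= e & e *+ n <= d].
Proof.
move=> unp itp; elim: n d => // -[|n] IH d _ d0 xd.
  by exists d; rewrite mulr1n.
have dn k : d <= d *+ k.+1.
  by rewrite mulrS -{1}(addr0 d) po_lerD// po_mulrn_ge0.
have xd1 : x <= d.
  by apply: (unperforated_le unp (ltn0Sn n.+1)); exact: le_trans xd (dn _).
have xnd : 0 <= d - x *+ n.+1.
  rewrite po_subr_ge0; apply: (unperforated_le unp (ltn0Sn n.+1)).
  rewrite mulrnAC; apply: le_trans (po_lerMn2r n.+1 xd) _.
  by rewrite [leRHS]mulrS -[leLHS]add0r po_lerD.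
have xxnd : x <= d - x *+ n.+1 by rewrite po_lerBrDr -mulrS.
have [e1 [e10 xe1 e1d]] := itp 0 x d (d - x *+ n.+1) d0 xnd xd1 xxnd.
rewrite po_lerBrDr addrC -po_lerBrDr => xe1d.
have [|e2 [e20 xe2 e2d]] := IH (d - e1) isT _ xe1d; first by rewrite po_subr_ge0.
have [e [e0 xe ee1 ee2]] := itp 0 x e1 e2 e10 e20 xe1 xe2.
exists e; split=> //; rewrite mulrS.
apply: le_trans (po_lerD ee1 (po_lerMn2r n.+1 ee2)) _.
by rewrite addrC -po_lerBrDr.
Qed.

End POGroupTheory.

Section States.
Variables (R : realType) (G : poGroupType) (u : G).
Implicit Types (s t : states R u) (x y z : G).

Lemma stateD s x y : s (x + y) = s x + s y.
Proof. by have [->] := stateP s. Qed.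

Lemma state_le s x y : x <= y -> s x <= s y.
Proof. by have [_ + _] := stateP s; apply. Qed.

Lemma state_unit s : s u = 1.
Proof. by have [] := stateP s. Qed.

Lemma state0 s : s 0 = 0.
Proof. exact: additive0 (stateD s). Qed.

Lemma stateN s x : s (- x) = - s x.
Proof. exact: additiveN (stateD s) x. Qed.

Lemma stateB s x y : s (x - y) = s x - s y.
Proof. by rewrite stateD stateN. Qed.

Lemma stateMn s x n : s (x *+ n) = s x *+ n.
Proof. exact: additiveMn (stateD s) n x. Qed.

Lemma state_ge0 s x : 0 <= x -> 0 <= s x.
Proof. by move=> /(state_le s); rewrite state0. Qed.

(** The Goodearl-Handelman criterion. If [z] is not positive, then the gauge
    [f x = inf (k / n)], over the integers [k] and [n > 0] with
    [n x <= k u], is nonnegative at [- z]; an additive map below [f] with the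
    same value at [- z] is a state that is not positive at [z]. *)
Lemma states_pos z : unperforated G -> order_unit u ->
  (forall s, 0 < s z) -> 0 <= z.
Proof.
move=> unp [u0 uunit] zpos; apply/negPn/negP => nz.
have nu0 : ~~ (u <= 0).
  apply/negP => u_le0; move/negP: nz; apply.
  have [n n0 zn] := uunit (- z); rewrite -po_lerN2 oppr0.
  by apply: le_trans zn _; have := po_lerMn2r n u_le0; rewrite mul0rn.
(* As [u <= 0] fails, the multiples of [u] are ordered as their coefficients. *)
have unit_le a b : u *+ b <= u *+ a -> (b <= a)%N.
  rewrite leqNgt => ba; apply/negP => lt_ab; move/negP: nu0; apply.
  have h : (0 < b - a)%N by rewrite subn_gt0.
  apply: (unperforated_le unp h); rewrite mul0rn mulrnBr 1?ltnW//.
  by rewrite -(subrr (u *+ a)) po_lerD.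
(* The integer [k] of the gauge is split as [a - b] with natural [a] and [b]. *)
pose A x := [set r : R | exists a b n : nat,
  [/\ (0 < n)%N, x *+ n + u *+ b <= u *+ a & r = (a%:R - b%:R) / n%:R]].
pose f x := inf (A x).
have A0 x : A x !=set0.
  have [n n0 xn] := uunit x.
  by exists ((n%:R - 0%:R) / 1%:R), n, 0%N, 1%N; rewrite mulr1n mulr0n addr0.
have lbA x : exists c, lbound (A x) c.
  have [m m0 xm] := uunit (- x); exists (- m%:R) => _ [a [b [n [n0 h ->]]]].
  rewrite ler_pdivlMr ?ltr0n// mulNr -natrM lerNl opprB lerBlDr -natrD ler_nat.
  apply: unit_le; rewrite mulrnDr.
  rewrite -(addKr (x *+ n) (u *+ b)) -mulNrn; apply: po_lerD => //.
  by rewrite mulrnA; exact: po_lerMn2r.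
have fle x a b n : (0 < n)%N -> x *+ n + u *+ b <= u *+ a ->
    f x <= (a%:R - b%:R) / n%:R.
  by move=> n0 h; apply: ge_inf; [exact: lbA|exists a, b, n].
have lef x c : (forall a b n, (0 < n)%N -> x *+ n + u *+ b <= u *+ a ->
    c <= (a%:R - b%:R) / n%:R) -> c <= f x.
  by move=> h; apply: lb_le_inf => // _ [a [b [n [n0 ? ->]]]]; exact: h.
have sf : sublinear f.
  split=> [x y|j x].
    rewrite -lerBlDr; apply: (lef) => a b n n0 xab; rewrite lerBlDr -lerBlDl.
    apply: (lef) => a' b' n' n'0 yab; rewrite lerBlDl.
    have -> : (a%:R - b%:R) / n%:R + (a'%:R - b'%:R) / n'%:R =
      ((a * n' + a' * n)%:R - (b * n' + b' * n)%:R) / (n * n')%:R :> R.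
      by rewrite addf_div ?pnatr_eq0 -?lt0n// !(natrD, natrM); congr (_ / _); lra.
    apply: fle; first by rewrite muln_gt0 n0.
    have := po_lerD (po_lerMn2r n' xab) (po_lerMn2r n yab).
    rewrite !mulrnDl -!mulrnA addrACA !mulrnDr [(n' * n)%N]mulnC.
    by rewrite -!mulrnDl.
  have [->|j0] := posnP j.
    rewrite !mulr0n; apply/eqP; rewrite eq_le; apply/andP; split.
      have -> : 0 = (0%:R - 0%:R) / 1%:R :> R by rewrite subr0 mul0r.
      by apply: fle => //; rewrite mul0rn addr0.
    apply: (lef) => a b n n0; rewrite mul0rn add0r => /unit_le ba.
    by rewrite divr_ge0// subr_ge0 ler_nat.
  apply/eqP; rewrite eq_le; apply/andP; split.
    rewrite -[leRHS]mulr_natl -ler_pdivrMl ?ltr0n//.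
    apply: (lef) => a b n n0 h; rewrite ler_pdivrMl ?ltr0n//.
    have -> : j%:R * ((a%:R - b%:R) / n%:R) =
        ((a * j)%:R - (b * j)%:R) / n%:R :> R.
      by rewrite !natrM -mulrBl mulrA; congr (_ / _); lra.
    apply: fle => //; have := po_lerMn2r j h.
    by rewrite mulrnDl -!mulrnA mulnC.
  apply: (lef) => a b n n0 h; rewrite -[leLHS]mulr_natl.
  have -> : (a%:R - b%:R) / n%:R = j%:R * ((a%:R - b%:R) / (j * n)%:R) :> R.
    by rewrite natrM invfM [RHS]mulrCA mulVKf// pnatr_eq0 -lt0n.
  rewrite ler_pM2l ?ltr0n//; apply: fle; first by rewrite muln_gt0 j0.
  by rewrite mulrnA.
have [t [tD tf tz]] := hahn_banach_zmod (- z) sf.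
have tN := additiveN tD.
have tle x a b : x + u *+ b <= u *+ a -> t x <= a%:R - b%:R.
  move=> h; apply: le_trans (tf x) _; rewrite -[leRHS]divr1.
  exact: (fle x a b 1%N).
have st : is_state u t.
  split=> [//|x y xy|].
    rewrite -subr_le0 -tN -tD -(subrr 0%:R).
    by apply: (tle _ 0%N 0%N); rewrite !mulr0n addr0 -po_lerN2 oppr0 opprB po_subr_ge0.
  apply/eqP; rewrite eq_le; apply/andP; split.
    by rewrite -[leRHS]subr0; apply: (tle u 1%N 0%N); rewrite addr0.
  rewrite -lerN2 -tN -[leRHS]sub0r.
  by apply: (tle (- u) 0%N 1%N); rewrite addNr.
have := zpos (exist _ t (mem_set st)).
rewrite /state_fun/= ltNge; apply/negP/negPn.
rewrite -oppr_ge0 -tN tz; apply: (lef) => a b n n0.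
have [ba _|ab] := leqP b a; first by rewrite divr_ge0// subr_ge0 ler_nat.
move=> h; exfalso; move/negP: nz; apply.
apply: (unp n) => //; rewrite -po_lerN2 oppr0 -mulNrn.
move: h; rewrite -po_lerBrDr => h; apply: le_trans h _.
rewrite -po_lerN2 oppr0 opprB -mulrnBr 1?ltnW//.
exact: po_mulrn_ge0.
Qed.

End States.

(** * Extremal states of interpolation groups *)

Section ExtremeStates.
Variables (R : realType) (G : poGroupType) (u : G).
Hypotheses (unp : unperforated G) (itp : interpolation G).
Hypothesis uunit : order_unit u.
Implicit Types (s : states R u) (f : G -> R) (x d : G).

Lemma additive_eq0 f : {morph f : x y / x + y} -> (forall x, 0 <= x -> 0 <= f x) ->
  f u = 0 -> forall x, f x = 0.
Proof.
move=> fD f0 fu; have fN := additiveN fD.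
have fle x : f x <= 0.
  have [n n0 xn] := uunit.2 x; rewrite -po_subr_ge0 in xn.
  by have := f0 _ xn; rewrite fD fN (additiveMn fD) fu mul0rn; lra.
by move=> x; have := fle x; have := fle (- x); rewrite fN; lra.
Qed.

(** Normalizing [f] and [s - f] to states writes [s] as a proper convex
    combination of them, unless [f u] is [0] or [1]. *)
Lemma extreme_dominated s f : extreme_point s -> {morph f : x y / x + y} ->
  (forall x, 0 <= x -> 0 <= f x <= s x) -> forall x, f x = f u * s x.
Proof.
move=> exs fD fs; have fN := additiveN fD; set c := f u.
have /andP[c0] := fs _ uunit.1; rewrite state_unit -/c => c1.
have [cz|cn0] := eqVneq c 0.
  move=> x; rewrite cz mul0r; apply: (additive_eq0 fD) => // y /fs.
  by case/andP.
have [ce1|cn1] := eqVneq c 1.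
  move=> x; rewrite ce1 mul1r; apply/eqP; rewrite -subr_eq0; apply/eqP; move: x.
  suff gz x : s x - f x = 0 by move=> x; have := gz x; lra.
  apply: (@additive_eq0 (fun x => s x - f x)).
  - by move=> y z; rewrite stateD fD; lra.
  - by move=> y /fs; rewrite subr_ge0 => /andP[].
  - by rewrite state_unit -/c ce1 subrr.
have {cn0}c0 : 0 < c by rewrite lt0r cn0.
have {cn1}c1 : c < 1 by rewrite lt_neqAle cn1.
have st1 : is_state u (fun x => c^-1 * f x).
  split=> [x y|x y xy|]; first by rewrite fD mulrDr.
    rewrite ler_pM2l ?invr_gt0//; rewrite -po_subr_ge0 in xy.
    by have /andP[] := fs _ xy; rewrite fD fN; lra.
  by rewrite mulVf ?gt_eqF.
have st2 : is_state u (fun x => (1 - c)^-1 * (s x - f x)).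
  split=> [x y|x y xy|]; first by rewrite stateD fD -mulrDr; congr (_ * _); lra.
    rewrite ler_pM2l ?invr_gt0 ?subr_gt0//; rewrite -po_subr_ge0 in xy.
    by have /andP[_] := fs _ xy; rewrite fD fN stateB; lra.
  by rewrite state_unit mulVf// subr_eq0 gt_eqF.
pose s1 : states R u := exist _ (fun x => c^-1 * f x) (mem_set st1).
pose s2 : states R u := exist _ (fun x => (1 - c)^-1 * (s x - f x)) (mem_set st2).
have [||| e1 _] := exs (Itv01 (ltW c0) (ltW c1)) s1 s2 => //.
  apply: state_ext => x.
  change (s x = c * (c^-1 * f x) + (1 - c) * ((1 - c)^-1 * (s x - f x))).
  by rewrite !mulVKf ?subr_eq0 ?gt_eqF// addrC subrK.
by move=> x; rewrite -e1 /state_fun/= mulVKf ?gt_eqF.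
Qed.

(** For a lattice-ordered group this says that an extremal state commutes with
    positive parts. The infimum [f] of [s d] over all [d >= 0, x] is sublinear,
    homogeneity being [riesz_root]; an additive map below [f] lies
    between [0] and [s], so by extremality it is a multiple [c s] with
    [0 <= c <= 1], and [c s x <= max(0, s x)]. *)
Lemma extreme_inf s x (e : R) : extreme_point s -> 0 < e ->
  exists d, [/\ 0 <= d, x <= d & s d < Num.max 0 (s x) + e].
Proof.
move=> exs e0.
pose A x := [set s d | d in [set d | 0 <= d /\ x <= d]].
pose f x := inf (A x).
have A0 x' : A x' !=set0.
  have [n n0 xn] := uunit.2 x'; exists (s (u *+ n)), (u *+ n) => //.
  by split=> //; apply: po_mulrn_ge0; exact: uunit.1.
have lbA x' : lbound (A x') 0 by move=> _ [d [d0 _] <-]; exact: state_ge0.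
have fle x' d : 0 <= d -> x' <= d -> f x' <= s d.
  by move=> d0 xd; apply: ge_inf; [exists 0|exists d].
have lef x' c : (forall d, 0 <= d -> x' <= d -> c <= s d) -> c <= f x'.
  by move=> h; apply: lb_le_inf => // _ [d [d0 xd] <-]; exact: h.
have sf : sublinear f.
  split=> [y z|n y].
    rewrite -lerBlDr; apply: (lef) => d d0 yd; rewrite lerBlDr -lerBlDl.
    apply: (lef) => d' d'0 zd; rewrite lerBlDl -stateD.
    by apply: fle; [rewrite -(addr0 0) po_lerD|exact: po_lerD].
  have [->|n0] := posnP n.
    rewrite !mulr0n; apply/eqP; rewrite eq_le; apply/andP; split.
      by rewrite -(state0 s); exact: fle.
    by apply: (lef) => d d0 _; exact: state_ge0.
  apply/eqP; rewrite eq_le; apply/andP; split.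
    rewrite -[leRHS]mulr_natl -ler_pdivrMl ?ltr0n//.
    apply: (lef) => d d0 yd; rewrite ler_pdivrMl ?ltr0n// mulr_natl -stateMn.
    by apply: fle; [exact: po_mulrn_ge0|exact: po_lerMn2r].
  apply: (lef) => d d0 yd; have [d' [d'0 yd' d'd]] := riesz_root unp itp n0 d0 yd.
  apply: le_trans (state_le s d'd); rewrite stateMn ler_wMn2r//.
  exact: fle.
have [t [tD tf tx]] := hahn_banach_zmod x sf.
have tdom y : 0 <= y -> 0 <= t y <= s y.
  move=> y0; apply/andP; split; last by apply: le_trans (tf y) _; exact: fle.
  rewrite -oppr_le0 -(additiveN tD); apply: le_trans (tf _) _.
  by rewrite -(state0 s); apply: fle => //; rewrite -po_lerN2 opprK oppr0.
have := extreme_dominated exs tD tdom x; rewrite tx => fx.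
have /andP[c0 c1] := tdom _ uunit.1; rewrite state_unit in c1.
have fmax : f x <= Num.max 0 (s x).
  rewrite fx le_max; have [sx|sx] := leP 0 (s x).
    by rewrite orbC ler_piMl.
  by rewrite (mulr_ge0_le0 c0 (ltW sx)).
have [|_ [d [d0 xd] <-] sd] := @inf_adherent _ (A x) e e0; first by split=> //; exists 0.
by exists d; split=> //; apply: lt_le_trans sd _; rewrite lerD2r.
Qed.

End ExtremeStates.

(** * Compactness of the state space *)

(** A property of sets that is local, hereditary and stable under unions holds
    of compact sets. This form of compactness needs no choice of indices for a
    finite subcover and serves for all the covering arguments below. *)
Lemma compact_set_induction (T : topologicalType) (K : set T) (P : set T -> Prop) :
  compact K -> P set0 ->
  (forall A B, P A -> P B -> P (A `|` B)) ->
  (forall A B, A `<=` B -> P B -> P A) ->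
  (forall x, K x -> exists2 V, nbhs x V & P V) -> P K.
Proof.
move=> cK P0 PU PS PV; apply: contrapT => nPK.
pose F : set_system T := [set A | P (K `\` A)].
have FF : ProperFilter F.
  split; first by rewrite /F/= setD0.
  split=> [|A B FA FB|A B AB FA]; rewrite /F/=.
  - by apply: (PS _ _ _ P0) => x [] _; apply.
  - apply: (PS _ _ _ (PU _ _ FA FB)) => x [Kx] /not_andP[nA|nB]; [by left|by right].
  - by apply: (PS _ _ _ FA) => x [Kx nB]; split=> // /AB.
have [|x [Kx clx]] := cK F FF; first by apply: (PS _ _ _ P0) => x [] ? [].
have [V xV V_P] := PV x Kx.
have FV : F (~` V) by apply: (PS _ _ _ V_P) => y [_] /contrapT.
by have [y []] := clx _ _ FV xV.
Qed.

Section StateSpace.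
Variables (R : realType) (G : poGroupType) (u : G).
Hypothesis uunit : order_unit u.
Implicit Types s : states R u.

Lemma states_cvg (F : set_system (states R u)) s : Filter F ->
  (forall x, (fun t : states R u => t x) @ F --> s x) -> F --> s.
Proof.
move=> FF Fs A; rewrite nbhsE => -[B [[U oU <-] sU] UA].
have : (fun t : states R u => \val t : {ptws G -> R}) @ F --> (\val s : {ptws G -> R}).
  apply/cvg_sup => i.
  rewrite cvg_image; last by rewrite eqEsubset; split=> v // _; exists (fun=> v).
  move=> W /= => /(Fs i) Q; exists (@^~ i @^-1` W) => //.
  by rewrite eqEsubset; split => [j [? + <-//]|j Wj]; exists (fun=> j).
move=> /(_ U) FU; apply: filterS UA _; apply: FU.
exact: open_nbhs_nbhs.
Qed.

(** Along an ultrafilter, the values at each [x] stay in a bounded interval given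
    by the order-unit, hence converge, and the limits form a state. *)
Lemma states_compact : compact [set: states R u].
Proof.
rewrite compact_ultra => F FU _.
have FP : ProperFilter F by exact: ultra_proper.
have /choice[f fF] : forall x, exists c, (fun s : states R u => s x) @ F --> (c : R).
  move=> x; have [n n0 xn] := uunit.2 x; have [m m0 xm] := uunit.2 (- x).
  have Fnm : F ((fun s : states R u => s x) @^-1` `[- m%:R, n%:R]).
    apply: filterS (filterT : F setT) => s _ /=; rewrite in_itv/=.
    have := state_le s xn; have := state_le s xm.
    by rewrite stateN !stateMn state_unit; lra.
  have [c [_ clc]] := @segment_compact R (- m%:R) n%:R
    ((fun s : states R u => s x) @ F) _ Fnm.
  exists c => V Vc.
  have [//|FnV] := in_ultra_setVsetC ((fun s : states R u => s x) @^-1` V) FU.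
  by have [y []] := clc (~` V) V FnV Vc.
have st : is_state u f.
  split=> [x y|x y xy|].
  - have e : (fun s : states R u => s (x + y)) =
        (fun s : states R u => s x) \+ (fun s : states R u => s y).
      by apply/funext => s; exact: stateD.
    have := fF (x + y); rewrite e => /cvg_unique; apply; first exact: Rhausdorff.
    exact: (cvgD (fF x) (fF y)).
  - by apply: (ler_cvg_to (fF x) (fF y)); apply: nearW => s; exact: state_le.
  - have := fF u; rewrite (_ : (fun s : states R u => s u) = fun=> 1).
      by move=> /cvg_unique; apply; [exact: Rhausdorff|exact: cvg_cst].
    by apply/funext => s; exact: state_unit.
by exists (exist _ f (mem_set st)); split=> //=; exact: states_cvg.
Qed.

End StateSpace.

(** * Extreme points and maxima of convex functions *)

Lemma ereal_between (R : realType) (a b : \bar R) : (a < b)%E ->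
  exists2 r : R, (a < r%:E)%E & (r%:E < b)%E.
Proof.
case: a => [a| |]; case: b => [b| |] //; rewrite ?ltxx//.
- rewrite lte_fin => ab; exists ((a + b) / 2); rewrite lte_fin; lra.
- by move=> _; exists (a + 1); rewrite ?ltry// lte_fin ltrDl.
- by move=> _; exists (b - 1); rewrite ?ltNyr// lte_fin ltrBlDr ltrDl.
- by move=> _; exists 0; rewrite ?ltry ?ltNyr.
Qed.

Lemma usc_closed (R : realType) (T : topologicalType) (f : T -> \bar R) (r : R) :
  upper_semicontinuous f -> closed [set x | (r%:E <= f x)%E].
Proof.
move=> uf; rewrite -[X in closed X]setCK; apply: open_closedC.
rewrite openE => x /= /negP; rewrite -ltNge => /uf[V xV Vf].
by apply: filterS xV => y /Vf; rewrite ltNge => /negP.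
Qed.

(** If there were no maximum, then each point would have a neighbourhood on
    which [f] is dominated by one fixed value of [f] on [K]; compactness would
    give a value of [f] above all values of [f]. *)
Lemma usc_argmax (R : realType) (T : topologicalType) (f : T -> \bar R) (K : set T) :
  compact K -> K !=set0 -> upper_semicontinuous f ->
  exists2 x, K x & forall y, K y -> (f y <= f x)%E.
Proof.
move=> cK [x0 Kx0] uf; apply: contrapT => nomax.
have next x : K x -> exists2 y, K y & (f x < f y)%E.
  move=> Kx; apply: contrapT => nxt; apply: nomax; exists x => // y Ky.
  by rewrite leNgt; apply/negP => xy; apply: nxt; exists y.
pose P (W : set T) := exists2 y, K y & forall x, W x -> (f x < f y)%E.
suff [y Ky fy] : P K by have := fy _ Ky; rewrite ltxx.
apply: compact_set_induction => //.
- by exists x0.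
- move=> A B [a Ka fa] [b Kb fb]; have [ab|ba] := leP (f a) (f b).
    by exists b => // x [/fa xa|/fb//]; exact: lt_le_trans ab.
  by exists a => // x [/fa//|/fb xb]; exact: lt_trans ba.
- by move=> A B AB [b Kb fb]; exists b => // x /AB; exact: fb.
move=> x Kx; have [y Ky xy] := next x Kx.
have [r fxr fry] := ereal_between xy.
have [V xV Vr] := uf x r fxr; exists V => //; exists y => // z /Vr.
by move=> /lt_trans; exact.
Qed.

Section Bauer.
Variables (R : realType) (G : poGroupType) (u : G).
Hypothesis uunit : order_unit u.
Implicit Types (s a b : states R u) (x : G) (E : set (states R u)).

Lemma state_convE (t : {i01 R}) a b x :
  state_fun (a <| t |> b) x = t%:num * a x + (1 - t%:num) * b x.
Proof. by []. Qed.

(** A face, except that the set itself may fail to be convex, as the set of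
    maximum points of a convex function does in general. *)
Definition extremal_set E := forall (t : {i01 R}) a b,
  0 < t%:num -> t%:num < 1 -> E (a <| t |> b) -> E a /\ E b.

Lemma eval_usc x : upper_semicontinuous (fun s : states R u => (s x)%:E).
Proof.
move=> s r; rewrite lte_fin => sr; exists [set t : states R u | t x < r] => //.
exact: (@Defs.eval_continuous R G u x s _ (lt_nbhsl sr)).
Qed.

Lemma eval_gt_nbhs x s (r : R) : r < s x -> nbhs s [set t : states R u | r < t x].
Proof.
by move=> rs; exact: (@Defs.eval_continuous R G u x s _ (lt_nbhsr rs)).
Qed.

Lemma eval_superlevel x E (s0 : states R u) : closed E -> extremal_set E ->
  (forall s, E s -> s x <= s0 x) ->
  closed (E `&` [set s : states R u | s0 x <= s x]) /\
  extremal_set (E `&` [set s : states R u | s0 x <= s x]).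
Proof.
move=> cE eE smax; split.
  apply: closedI => //.
  exact: (@usc_closed R (states R u) _ (s0 x) (@eval_usc x)).
move=> t a b t0 t1 [/(eE _ _ _ t0 t1)[Ea Eb]]; rewrite /= state_convE => le0.
by have := smax _ Ea; have := smax _ Eb; split; split=> //=; nra.
Qed.

(** The Krein-Milman argument: on a minimal closed extremal set every
    evaluation is constant, since the points where it is maximal form a closed
    extremal subset. As evaluations separate states, the set is a point. *)
Lemma extremal_set_extreme_point E : closed E -> E !=set0 -> extremal_set E ->
  exists2 s, E s & extreme_point s.
Proof.
move=> cE E0 eE.
have cS := @states_compact R G u uunit.
pose ok (F : set (states R u)) := [/\ closed F, F !=set0, extremal_set F & F `<=` E].
pose T := {F | ok F}.
pose below (F F' : T) := `[< sval F' `<=` sval F >].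
have [] := @Zorn T below.
- by move=> F; apply/asboolP.
- move=> F1 F2 F3 /asboolP F12 /asboolP F23; apply/asboolP.
  exact: subset_trans F12.
- move=> [F1 o1] [F2 o2] /asboolP F12 /asboolP F21; apply: eq_exist.
  exact/seteqP.
- move=> A totA; have [->|/set0P[F0 AF0]] := eqVneq A set0.
    by exists (exist _ E (And4 cE E0 eE (@subset_refl _ E))).
  pose I : set (states R u) := \bigcap_(F in A) sval F.
  have okI : ok I.
    split.
    - by apply: closed_bigI => F _; case: (svalP F).
    - apply: contrapT => I0.
      pose P (W : set (states R u)) := exists2 F : T, A F & W `&` sval F = set0.
      have [F AF] : P [set: states R u].
        apply: compact_set_induction => //.
        + by exists F0 => //; rewrite set0I.
        + move=> B C [F AF BF] [F' AF' CF'].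
          have [/asboolP sub|/asboolP sub] := totA _ _ AF AF'.
            exists F' => //; rewrite setIUl CF' setU0.
            by apply/seteqP; split=> // x [Bx /sub Fx]; rewrite -BF.
          exists F => //; rewrite setIUl BF set0U.
          by apply/seteqP; split=> // x [Cx /sub Fx]; rewrite -CF'.
        + move=> B C BC [F AF CF]; exists F => //.
          by apply/seteqP; split=> // x [/BC Cx Fx]; rewrite -CF.
        + move=> s _; have [F AF nFs] : exists2 F, A F & ~ sval F s.
            apply: contrapT => h; apply: I0; exists s => F AF.
            by apply: contrapT => nF; apply: h; exists F.
          exists (~` sval F); last by exists F => //; rewrite setICl.
          apply: open_nbhs_nbhs; split=> //; apply: closed_openC.
          by case: (svalP F).
      by rewrite setTI => F_eq0; case: (svalP F) => _; rewrite F_eq0 => -[].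
    - move=> t a b t0 t1 Iab; split=> F AF;
        by have [_ _ /(_ t a b t0 t1 (Iab F AF))[]] := svalP F.
    - by apply: subset_trans (bigcap_inf AF0) _; case: (svalP F0).
  by exists (exist _ I okI) => F AF; apply/asboolP; exact: bigcap_inf.
move=> [M [cM M0 eM ME]] Mmin.
have Mconst x a b : M a -> M b -> a x = b x.
  move=> Ma Mb.
  have [s0' Ms0 s0max] := usc_argmax (subclosed_compact cM cS (@subsetT _ M)) M0
    (@eval_usc x).
  pose s0 : states R u := s0'.
  have [cM' eM'] := @eval_superlevel x M s0 cM eM s0max.
  have ok' : ok (M `&` [set s : states R u | s0 x <= s x]).
    by split=> //; [exists s0; split=> /=|exact: subset_trans (@subIsetl _ _ _) ME].
  have /(congr1 sval)/= MM' :=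
    Mmin (exist _ _ ok') (introT (asboolP _) (@subIsetl _ _ _)).
  have Meq s : M s -> s x = s0 x.
    move=> Ms; apply/eqP; rewrite eq_le; have := s0max _ Ms; rewrite lee_fin => ->.
    by move: Ms; rewrite -MM' => -[].
  by rewrite (Meq a) ?(Meq b).
have [s Ms] := M0; exists s; first exact: (ME s Ms).
move=> t a b t0 t1 sab; have [|Ma Mb] := eM t a b t0 t1; first by rewrite -sab.
by split; apply: state_ext => x; exact: Mconst.
Qed.

(** The points where a convex function attains its maximum form an extremal
    set, and upper semicontinuity makes this set closed and nonempty. *)
Lemma bauer_maximum (f : states R u -> \bar R) : [set: states R u] !=set0 ->
  (forall s, (f s < +oo)%E) -> convex_efun f -> upper_semicontinuous f ->
  exists2 e, extreme_point e & forall s, (f s <= f e)%E.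
Proof.
move=> S0 fy cf uf.
have [s0 _ fmax] := usc_argmax (@states_compact R G u uunit) S0 uf.
case fs0 : (f s0) => [r| |]; last 2 first.
- by have := fy s0; rewrite fs0.
- have [e _ exe] := extremal_set_extreme_point (@closedT _) S0
    (fun _ _ _ _ _ _ => conj I I).
  exists e => // s; apply: le_trans (fmax s I) _.
  by rewrite fs0 leNye.
have [|||e] := @extremal_set_extreme_point [set s | (r%:E <= f s)%E].
- exact: usc_closed.
- by exists s0; rewrite /= fs0.
- move=> t a b t0 t1 /= /le_trans/(_ (cf t a b)).
  have := fmax a I; have := fmax b I; rewrite fs0.
  have tt : 0 < 1 - t%:num by rewrite subr_gt0.
  case fa : (f a) => [y| |]; case fb : (f b) => [z| |]; rewrite ?leye_eq//.
  + by rewrite -!EFinM -EFinD !lee_fin => ? ? ?; split; nra.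
  + by rewrite gt0_muleNy ?lte_fin// addeNy leeNy_eq.
  + by rewrite gt0_muleNy ?lte_fin// addNye leeNy_eq.
  + by rewrite gt0_muleNy ?lte_fin// addNye leeNy_eq.
- move=> re exe; exists e => // s; apply: le_trans (fmax s I) _.
  by rewrite fs0.
Qed.

End Bauer.

(** * Directed sets of elements above a convex function *)

Section ConvexUsc.
Variables (R : realType).

Lemma convex_efunD (S : convType R) (f : S -> \bar R) (h : S -> R) :
  convex_efun f -> affine_fun h -> convex_efun (fun s => f s + (h s)%:E)%E.
Proof.
move=> cf ah t a b; rewrite ah.
rewrite !muleDr ?fin_num_adde_defl// addeACA EFinD !EFinM.
by rewrite leeD2r.
Qed.

Lemma convex_efun_max (S : convType R) (f g : S -> \bar R) :
  convex_efun f -> convex_efun g -> convex_efun (fun s => maxe (f s) (g s)).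
Proof.
move=> cf cg t a b.
have t1 : (0 <= (1 - t%:num)%:E :> \bar R)%E by rewrite lee_fin subr_ge0.
rewrite ge_max; apply/andP; split.
  by apply: le_trans (cf t a b) _; rewrite leeD// lee_wpmul2l ?lee_fin ?le_max ?lexx.
by apply: le_trans (cg t a b) _; rewrite leeD// lee_wpmul2l ?lee_fin ?le_max ?lexx ?orbT.
Qed.

Lemma affine_convex_efun (S : convType R) (h : S -> R) :
  affine_fun h -> convex_efun (fun s => (h s)%:E).
Proof. by move=> ah t a b; rewrite ah EFinD !EFinM. Qed.

Lemma concave_efunN (S : convType R) (q : S -> \bar R) :
  (forall s, (-oo < q s)%E) -> concave_efun q -> convex_efun (fun s => - q s)%E.
Proof.
move=> qNy cq t a b; rewrite !muleN -oppeD ?leeN2; first exact: cq.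
have t1 : 0 <= 1 - t%:num :> R by rewrite subr_ge0.
have gtNy : forall r : R, 0 <= r -> forall s, (-oo < r%:E * q s)%E.
  move=> r r0 s; have := qNy s; case: (q s) => [y| |]//= _.
    by rewrite -EFinM ltNyr.
  have [->|rn0] := eqVneq r 0; first by rewrite mul0e.
  by rewrite gt0_muley// lte_fin lt0r rn0.
by apply: ltninfty_adde_def; rewrite inE; exact: gtNy.
Qed.

Lemma usc_addr (T : topologicalType) (f : T -> \bar R) (h : T -> R) :
  upper_semicontinuous f -> upper_semicontinuous (fun x => (h x)%:E) ->
  upper_semicontinuous (fun x => f x + (h x)%:E)%E.
Proof.
move=> uf uh x r fh; have : (f x < (r - h x)%:E)%E by rewrite EFinB lteBrDr.
move=> /ereal_between[c fc]; rewrite lte_fin => cr.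
have [V xV Vf] := uf x c fc.
have [|W xW Wh] := uh x (r - c); first by rewrite lte_fin; lra.
exists (V `&` W); first exact: filterI.
move=> y [/Vf fy /Wh]; rewrite lte_fin => hy.
apply: (@lt_le_trans _ _ (c%:E + (h y)%:E)%E); first by rewrite lteD2rE.
by rewrite -EFinD lee_fin; lra.
Qed.

Lemma usc_max (T : topologicalType) (f g : T -> \bar R) :
  upper_semicontinuous f -> upper_semicontinuous g ->
  upper_semicontinuous (fun x => maxe (f x) (g x)).
Proof.
move=> uf ug x r; rewrite gt_max => /andP[/uf[V xV Vf] /ug[W xW Wg]].
exists (V `&` W); first exact: filterI.
by move=> y [/Vf fy /Wg gy]; rewrite gt_max fy.
Qed.

Lemma usc_cst (T : topologicalType) (c : R) :
  upper_semicontinuous (fun _ : T => c%:E).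
Proof. by move=> x r cr; exists setT => //; exact: filterT. Qed.

Lemma lscN (T : topologicalType) (q : T -> \bar R) :
  lower_semicontinuous q -> upper_semicontinuous (fun x => - q x)%E.
Proof.
move=> lq x r; rewrite lteNl -EFinN => /lq[V xV Vq]; exists V => // y /Vq.
by rewrite lteNl.
Qed.

End ConvexUsc.

Section Directed.
Variables (R : realType) (G : poGroupType) (u : G).
Hypothesis uunit : order_unit u.
Implicit Types (s : states R u) (b c : G).

(** The supremum [h] of the evaluations at members of [H] is affine because [H]
    is directed, and lower semicontinuous as a supremum of continuous functions.
    So [p - h] is convex and upper semicontinuous; it is negative at extreme
    points, hence everywhere. Compactness and directedness then replace [h] by
    one member of [H]. *)
Lemma directed_above (H : set G) (p : states R u -> \bar R) :
  H !=set0 -> (exists c, forall b, H b -> b <= c) ->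
  (forall b1 b2, H b1 -> H b2 -> exists b, [/\ H b, b1 <= b & b2 <= b]) ->
  (forall s, (p s < +oo)%E) -> convex_efun p -> upper_semicontinuous p ->
  (forall s, extreme_point s -> exists2 b, H b & (p s < (s b)%:E)%E) ->
  exists2 b, H b & forall s, (p s < (s b)%:E)%E.
Proof.
move=> [b0 Hb0] [c Hc] Hdir py cp up exH.
pose A s := [set s b | b in H].
pose h s := sup (A s).
have A0 s : A s !=set0 by exists (s b0), b0.
have ubA s : ubound (A s) (s c) by move=> _ [b Hb <-]; exact/state_le/Hc.
have hge s b : H b -> s b <= h s.
  by move=> Hb; apply: ub_le_sup; [exists (s c)|exists b].
have hlub s r : (forall b, H b -> s b <= r) -> h s <= r.
  by move=> Hr; apply: ge_sup => // _ [b Hb <-]; exact: Hr.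
have hgt s r : r < h s -> exists2 b, H b & r < s b.
  move=> rh; have [_ [b Hb <-] rb] := sup_gt (A0 s) rh.
  by exists b.
have ah (t : {i01 R}) s1 s2 : h (s1 <| t |> s2) = t%:num * h s1 + (1 - t%:num) * h s2.
  apply/eqP; rewrite eq_le; apply/andP; split.
    apply: hlub => b Hb; rewrite state_convE.
    by rewrite lerD// ler_wpM2l ?subr_ge0// hge.
  have t1 : 0 <= 1 - t%:num by rewrite subr_ge0.
  apply/ler_addgt0Pr => e e0.
  have [b1 Hb1 hb1] : exists2 b, H b & h s1 - e < s1 b by apply: hgt; lra.
  have [b2 Hb2 hb2] : exists2 b, H b & h s2 - e < s2 b by apply: hgt; lra.
  have [b [Hb b1b b2b]] := Hdir _ _ Hb1 Hb2.
  have := hge (s1 <| t |> s2) _ Hb; rewrite state_convE.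
  have := state_le s1 b1b; have := state_le s2 b2b.
  have t0 : 0 <= t%:num by [].
  move=> ? ? ?; have : t%:num * (h s1 - e) <= t%:num * s1 b.
    by rewrite ler_wpM2l//; lra.
  have : (1 - t%:num) * (h s2 - e) <= (1 - t%:num) * s2 b.
    by rewrite ler_wpM2l//; lra.
  lra.
pose f s := (p s + (- h s)%:E)%E.
have fy s : (f s < +oo)%E.
  by rewrite /f; have := py s; case: (p s) => //= r _; rewrite ltry.
have cf : convex_efun f.
  apply: convex_efunD => // t s1 s2; rewrite ah; lra.
have uf : upper_semicontinuous f.
  apply: usc_addr => // s r; rewrite lte_fin => hr.
  have [|b Hb rb] := hgt s (- r); first by lra.
  exists [set t : states R u | - r < t b]; first exact: eval_gt_nbhs.
  by move=> t /= rt; rewrite lte_fin; have := hge t b Hb; lra.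
have ph s : (p s < (h s)%:E)%E.
  have [e exe fe] := bauer_maximum uunit (ex_intro _ s I) fy cf uf.
  have [b Hb pb] := exH e exe.
  have : (f s < 0)%E.
    apply: le_lt_trans (fe s) _; rewrite /f EFinN sube_lt0 ?orbT//.
    by apply: lt_le_trans pb _; rewrite lee_fin hge.
  by rewrite /f EFinN sube_lt0 ?orbT.
pose P (W : set (states R u)) := exists2 b, H b & forall s, W s -> (p s < (s b)%:E)%E.
suff [b Hb pb] : P setT by exists b => // s; exact: pb.
apply: compact_set_induction (states_compact uunit) _ _ _ _.
- by exists b0.
- move=> V W [b1 Hb1 Vb1] [b2 Hb2 Wb2]; have [b [Hb b1b b2b]] := Hdir _ _ Hb1 Hb2.
  exists b => // s [/Vb1|/Wb2] ps; apply: lt_le_trans ps _; rewrite lee_fin.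
    exact: state_le.
  exact: state_le.
- by move=> V W VW [b Hb Wb]; exists b => // s /VW; exact: Wb.
move=> s _; have [r pr rh] := ereal_between (ph s).
have [b Hb rb] := hgt s r rh.
have [V sV Vp] := up s r pr.
exists (V `&` [set t : states R u | r < t b]).
  by apply: filterI => //; exact: eval_gt_nbhs.
exists b => // t [/Vp pt rt]; apply: lt_trans pt _.
by rewrite lte_fin.
Qed.

End Directed.

(** * Elements that are small at one extremal state and large elsewhere *)

(** Pigeonhole on the fractional parts of [r j] for [j <= M + 1], sorted into
    [M + 1] intervals of length less than [d]. *)
Lemma dirichlet (R : realType) (r d : R) : 0 < d ->
  exists n : nat, exists m : int, (0 < n)%N /\ `|r *+ n - m%:~R| < d.
Proof.
move=> d0.
have [M dM] : exists M : nat, d^-1 < M.+1%:R.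
  exists (Num.trunc d^-1); exact: truncnS_gt.
pose frac (j : nat) := r *+ j - (Num.floor (r *+ j))%:~R.
have frac0 j : 0 <= frac j by rewrite subr_ge0 floor_le_tmp.
have frac1 j : frac j < 1.
  by rewrite ltrBlDr addrC -(intrD _ _ 1) floorD1_gt.
pose bin j := Num.trunc (frac j * M.+1%:R).
have bin_lt j : (bin j < M.+1)%N.
  rewrite -(ltr_nat R); apply: (@le_lt_trans _ _ (frac j * M.+1%:R)).
    by rewrite truncn_le mulr_ge0.
  by rewrite gtr_pMl ?ltr0n.
have [j [k [jk ejk]]] : exists j k : nat, (j < k)%N /\ bin j = bin k.
  pose g (j : 'I_M.+2) : 'I_M.+1 := Ordinal (bin_lt j).
  have /injectivePn[j [k njk gjk]] : ~~ injectiveb g.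
    apply/negP => /injectiveP/leq_card; rewrite !card_ord ltnn//.
  have /(congr1 val)/= ejk := gjk.
  have [jk|kj|/val_inj jk] := ltngtP j k.
  - by exists j, k.
  - by exists k, j.
  - by rewrite jk eqxx in njk.
exists (k - j)%N, (Num.floor (r *+ k) - Num.floor (r *+ j)); split.
  by rewrite subn_gt0.
have -> : r *+ (k - j) - (Num.floor (r *+ k) - Num.floor (r *+ j))%:~R =
    frac k - frac j.
  by rewrite mulrnBr 1?ltnW// intrB /frac; lra.
have M0 : 0 < M.+1%:R :> R by rewrite ltr0n.
have Md : 1 < d * M.+1%:R by rewrite mulrC -ltr_pdivrMr// div1r.
rewrite -(ltr_pM2r M0); apply: lt_trans Md.
rewrite -{1}(gtr0_norm M0) -normrM mulrBl.
have b j' : (bin j')%:R <= frac j' * M.+1%:R < (bin j')%:R + 1.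
  by rewrite natr1; apply: truncn_itv; rewrite mulr_ge0.
have := b j; have := b k; rewrite ejk => /andP[? ?] /andP[? ?].
rewrite ltr_norml; apply/andP; split; lra.
Qed.

Section Peak.
Variables (R : realType) (G : poGroupType) (u : G).
Hypotheses (unp : unperforated G) (itp : interpolation G).
Hypothesis uunit : order_unit u.
Implicit Types (s t : states R u) (x y : G).

Lemma state_unitMz s (m : int) : s (u *~ m) = m%:~R.
Proof.
case: m => n; first by rewrite -pmulrn stateMn state_unit.
by rewrite NegzE mulrNz stateN mulrNz -!pmulrn stateMn state_unit.
Qed.

(** By compactness it suffices to dominate [N] near one state [t] of [K], with
    arbitrarily small values at [s0]. Some [x] takes a value at [t] which is
    larger than its value at [s0] by more than [|N| + 1]. By Dirichlet, a
    multiple [n x] differs from a multiple of [u] by an element [y] with [s0 y]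
    close to [0], while the difference [t y - s0 y] has only grown. Replacing
    [y] by a positive majorant as in [extreme_inf] keeps the value at
    [s0] small. *)
Lemma extreme_peak s0 (K : set (states R u)) (N d : R) : extreme_point s0 ->
  closed K -> ~ K s0 -> 0 < d ->
  exists a, [/\ 0 <= a, s0 a < d & forall t, K t -> N < t a].
Proof.
move=> exs0 cK nKs0; move: d.
pose P (W : set (states R u)) := forall d : R, 0 < d ->
  exists a, [/\ 0 <= a, s0 a < d & forall t, W t -> N < t a].
suff : P K by [].
have compK : compact K by exact: subclosed_compact cK (states_compact uunit) _.
apply: compact_set_induction compK _ _ _ _.
- by move=> d d0; exists 0; rewrite state0.
- move=> V W PV PW d d0; have d20 : 0 < d / 2 by lra.
  have [a [a0 sa Va]] := PV _ d20; have [b [b0 sb Wb]] := PW _ d20.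
  exists (a + b); split.
  + by rewrite -[0]addr0 po_lerD.
  + by rewrite stateD; lra.
  + move=> t Wt; rewrite stateD.
    have := state_ge0 t a0; have := state_ge0 t b0.
    by case: Wt => [/Va|/Wb]; lra.
- move=> V W VW PW d d0; have [a [a0 sa Wa]] := PW d d0.
  by exists a; split=> // t /VW; exact: Wa.
move=> t1 Kt; pose t : states R u := t1.
have [x xt] : exists x, s0 x < t x.
  apply: contrapT => nx; apply: nKs0; suff -> : s0 = t by exact: Kt.
  apply: state_ext => x; have [sx|tx|//] := ltgtP (s0 x) (t x).
    by exfalso; apply: nx; exists x.
  by exfalso; apply: nx; exists (- x); rewrite !stateN; lra.
have [k kx] : exists k : nat, `|N| + 1 < (t x - s0 x) *+ k.
  exists (Num.trunc ((`|N| + 1) / (t x - s0 x))).+1.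
  by rewrite -mulr_natl -ltr_pdivrMr ?subr_gt0// truncnS_gt.
(* The multiple [k x] separates [t] from [s0] by more than [|N| + 1]; the
   excess [1] absorbs the Dirichlet error at [s0]. *)
exists [set t' : states R u | s0 (x *+ k) + `|N| + 1 < t' (x *+ k)].
  by apply: eval_gt_nbhs; rewrite !stateMn -addrA -ltrBrDl -mulrnBl.
move=> d d0.
have d'0 : 0 < Num.min 1 (d / 2) by rewrite lt_min ltr01; lra.
have [n [m [n0 nm]]] := dirichlet (s0 (x *+ k)) d'0.
have [a [a0 ya sa]] := extreme_inf unp itp uunit (x *+ k *+ n - u *~ m)
  exs0 (divr_gt0 d0 (ltr0n _ 2)).
have sy : s0 (x *+ k *+ n - u *~ m) = s0 (x *+ k) *+ n - m%:~R.
  by rewrite stateB state_unitMz (stateMn _ _ n).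
rewrite sy in sa.
move: nm; rewrite lt_min !ltr_norml => /andP[/andP[n1 _] /andP[_ n2]].
exists a; split=> //.
  apply: lt_le_trans sa _; rewrite -lerBrDr ge_max; apply/andP; split; lra.
move=> t' /= t'x; apply: lt_le_trans (state_le t' ya).
rewrite stateB state_unitMz (stateMn _ _ n).
have : (`|N| + 1) *+ n <= (t' (x *+ k) - s0 (x *+ k)) *+ n.
  by rewrite ler_wMn2r//; lra.
have : `|N| + 1 <= (`|N| + 1) *+ n.
  by rewrite -[leRHS]mulr_natl ler_peMl// ler1n.
have := ler_norm N; rewrite mulrnBl; lra.
Qed.

End Peak.

(** * Strict and approximate interpolation between convex functions *)

Section Sandwich.
Variables (R : realType) (G : poGroupType) (u : G).
Hypotheses (unp : unperforated G) (itp : interpolation G).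
Hypothesis uunit : order_unit u.
Implicit Types (s t : states R u) (x y a b : G) (p r : states R u -> \bar R).

Lemma usc_bounded p : (forall s, (p s < +oo)%E) -> upper_semicontinuous p ->
  exists N : nat, forall s, (p s < N%:R%:E)%E.
Proof.
move=> py up.
pose P (W : set (states R u)) := exists N : nat, forall s, W s -> (p s < N%:R%:E)%E.
suff [N pN] : P setT by exists N => s; exact: pN.
apply: compact_set_induction (states_compact uunit) _ _ _ _.
- by exists 0%N.
- move=> V W [N VN] [M WM]; exists (maxn N M) => s [/VN|/WM] ps;
    apply: lt_le_trans ps _; rewrite lee_fin ler_nat; [exact: leq_maxl|exact: leq_maxr].
- by move=> V W VW [N WN]; exists N => s /VW; exact: WN.
move=> s _; have [c pc _] := ereal_between (py s).
have [V sV Vp] := up s c pc; exists V => //; exists (Num.trunc c).+1 => t /Vp pt.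
by apply: lt_trans pt _; rewrite lte_fin truncnS_gt.
Qed.

(** The common lower bounds of [a0] and [a1] are upward directed by
    interpolation, and at an extremal state their values approach
    [min(s a0, s a1)]. *)
Lemma majorants_directed p a0 a1 :
  (forall s, (p s < +oo)%E) -> convex_efun p -> upper_semicontinuous p ->
  (forall s, (p s < (s a0)%:E)%E) -> (forall s, (p s < (s a1)%:E)%E) ->
  exists b, [/\ forall s, (p s < (s b)%:E)%E, b <= a0 & b <= a1].
Proof.
move=> py cp up p0 p1.
suff [b [ba0 ba1] pb] : exists2 b, [set b | b <= a0 /\ b <= a1] b &
  forall s, (p s < (s b)%:E)%E by exists b.
apply: directed_above => //.
- have [n n0 an] := uunit.2 (- a0); have [m m0 am] := uunit.2 (- a1).
  have un k : 0 <= u *+ k by apply: po_mulrn_ge0; case: uunit.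
  exists (- (u *+ n + u *+ m)); split; rewrite -po_lerN2 opprK.
    by rewrite -[leLHS]addr0 po_lerD.
  by rewrite -[leLHS]add0r po_lerD.
- by exists a0 => b [].
- move=> b1 b2 [b10 b11] [b20 b21].
  by have [b [b1b b2b ba0 ba1]] := itp b10 b11 b20 b21; exists b.
move=> s exs.
have : (p s < (Num.min (s a0) (s a1))%:E)%E by rewrite EFin_min lt_min p0 p1.
move=> /ereal_between[c pc]; rewrite lte_fin => cmin.
have e0 : 0 < Num.min (s a0) (s a1) - c by rewrite subr_gt0.
have [d [d0 ad sd]] := extreme_inf unp itp uunit (a0 - a1) exs e0.
exists (a0 - d).
  by split; rewrite -po_lerN2 opprB po_lerBrDr ?addNr// addrC.
apply: lt_trans pc _; rewrite lte_fin stateB.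
move: sd; rewrite stateB; have [?|?] := leP (s a0) (s a1).
  by rewrite max_l; lra.
by rewrite max_r; lra.
Qed.

(** The lower bound on [p] makes the set of negatives of majorants of [p]
    bounded above in [G], as [directed_above] demands. *)
Lemma strict_sandwich_lbounded p r (N : nat) :
  (forall s, ((- N%:R)%:E <= p s)%E) ->
  (forall s, (p s < +oo)%E) -> convex_efun p -> upper_semicontinuous p ->
  (forall s, (r s < +oo)%E) -> convex_efun r -> upper_semicontinuous r ->
  (forall s, extreme_point s ->
     exists x, (p s < (s x)%:E)%E /\ (r s < (- s x)%:E)%E) ->
  exists x, forall s, (p s < (s x)%:E)%E /\ (r s < (- s x)%:E)%E.
Proof.
move=> pN py cp up ry cr ur exx.
have [M pM] := usc_bounded py up.
pose F := [set b : G | forall s, (p s < (s (- b))%:E)%E].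
suff [b Fb rb] : exists2 b, F b & forall s, (r s < (s b)%:E)%E.
  by exists (- b) => s; split; [exact: Fb|rewrite stateN opprK; exact: rb].
apply: directed_above => //.
- exists (- (u *+ M)) => s; rewrite opprK stateMn state_unit; exact: pM.
- exists (u *+ N) => b Fb; rewrite -po_subr_ge0; apply: (states_pos unp uunit) => s.
  have := le_lt_trans (pN s) (Fb s); rewrite lte_fin stateB stateN stateMn state_unit.
  lra.
- move=> b1 b2 F1 F2.
  have [b [pb b1b b2b]] := majorants_directed py cp up F1 F2.
  by exists (- b); split; [move=> s; rewrite opprK|
    rewrite -[b1]opprK po_lerN2|rewrite -[b2]opprK po_lerN2].
move=> s0 exs0; have [x [px rx]] := exx s0 exs0.
have [c rc] := ereal_between rx; rewrite lte_fin => cx.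
pose g s := (p s + (- s x)%:E)%E.
have ug : upper_semicontinuous g.
  apply: usc_addr => //.
  have -> : (fun s : states R u => (- s x)%:E) = (fun s : states R u => (s (- x))%:E).
    by apply/funext => s; rewrite stateN.
  exact: eval_usc.
have gE s : (0%:E <= g s)%E = ((s x)%:E <= p s)%E.
  by rewrite /g EFinN sube_ge0 ?orbT.
have [n n0 xn] := uunit.2 (- x).
have [|||a [a0 sa Ka]] := @extreme_peak R G u unp itp uunit s0
    [set s | (0%:E <= g s)%E] (M%:R + n%:R) (- s0 x - c) exs0.
- exact: usc_closed.
- by rewrite /= gE => /(lt_le_trans px); rewrite ltxx.
- by lra.
exists (- (x + a)); last first.
  apply: lt_trans rc _; rewrite lte_fin stateN stateD; lra.
move=> s; rewrite opprK stateD.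
have [Ks|nKs] := leP 0%:E (g s).
  apply: lt_trans (pM s) _; rewrite lte_fin.
  have := Ka s Ks; have := state_le s xn; rewrite stateN stateMn state_unit; lra.
have : (p s < (s x)%:E)%E by rewrite ltNge -gE -ltNge.
move=> /lt_le_trans; apply; rewrite lee_fin lerDl; exact: state_ge0.
Qed.

(** Truncating [p] from below at [- N - 1], where [r < N], leaves the hypothesis
    at extremal states intact: if the given [x] falls below the truncation, then
    [- N u] does instead. *)
Lemma strict_sandwich p r :
  (forall s, (p s < +oo)%E) -> convex_efun p -> upper_semicontinuous p ->
  (forall s, (r s < +oo)%E) -> convex_efun r -> upper_semicontinuous r ->
  (forall s, extreme_point s ->
     exists x, (p s < (s x)%:E)%E /\ (r s < (- s x)%:E)%E) ->
  exists x, forall s, (p s < (s x)%:E)%E /\ (r s < (- s x)%:E)%E.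
Proof.
move=> py cp up ry cr ur exx.
have [N rN] := usc_bounded ry ur.
pose p' s := maxe (p s) ((- N.+1%:R)%:E).
have pN s : ((- N.+1%:R)%:E <= p' s)%E by rewrite le_max lexx orbT.
have py' s : (p' s < +oo)%E by rewrite gt_max py ltry.
have cp' : convex_efun p'.
  by apply: convex_efun_max => //; apply: affine_convex_efun => t a b; lra.
have up' : upper_semicontinuous p' by apply: usc_max => //; exact: usc_cst.
have [|x xP] := strict_sandwich_lbounded pN py' cp' up' ry cr ur; last first.
  by exists x => s; have [] := xP s; rewrite gt_max => /andP[].
move=> s exs; have [x [px rx]] := exx s exs.
have [sN|sN] := ltP (- N.+1%:R) (s x).
  by exists x; rewrite gt_max px lte_fin.
exists (- (u *+ N)); rewrite stateN stateMn state_unit opprK; split; last exact: rN.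
have NN : - N.+1%:R < - N%:R :> R by rewrite ltrN2 ltr_nat.
rewrite gt_max lte_fin NN andbT; apply: lt_trans px _.
by rewrite lte_fin; exact: le_lt_trans NN.
Qed.

(** A point of the range that is not isolated yields arbitrarily small positive
    values, and their integer multiples are dense. *)
Lemma nondiscrete_dense s (c d : R) : ~ discrete_state s -> c < d ->
  exists x, c < s x < d.
Proof.
move=> nd cd; have dc : 0 < d - c by rewrite subr_gt0.
have [y [y0 yd]] : exists y, 0 < s y /\ s y < d - c.
  apply: contrapT => ny; apply: nd => _ [x _ <-]; split; first by apply/mem_set; exists x.
  exists (ball (s x) (d - c)); first exact: nbhsx_ballx.
  apply/seteqP; split=> [z [xz [x' _ xx']]|_ ->]; last first.
    by split; [exact: ballxx|exists x].
  subst z; move: xz; rewrite /ball/= ltr_distl => /andP[l1 l2].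
  have [xx'|xx'|//] := ltgtP (s x') (s x).
    by exfalso; apply: ny; exists (x - x'); rewrite stateB; lra.
  by exfalso; apply: ny; exists (x' - x); rewrite stateB; lra.
pose m := Num.floor (c / s y) + 1.
have sm : s (y *~ m) = m%:~R * s y.
  rewrite mulrzl; case: (m) => k; first by rewrite -!pmulrn stateMn.
  by rewrite NegzE !mulrNz stateN -!pmulrn stateMn.
exists (y *~ m); rewrite sm; have /andP[fl fu] := floor_itv (c / s y).
have ey : c = c / s y * s y by rewrite divfK// gt_eqF.
apply/andP; split; first by rewrite {1}ey ltr_pM2r.
have : (Num.floor (c / s y))%:~R * s y <= c by rewrite {2}ey ler_pM2r.
by rewrite /m intrD mulrDl mul1r; lra.
Qed.

(** At a nondiscrete extremal state [p <= - r] leaves, after both functions are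
    lowered by [e], an open interval of admissible values, which the dense range
    meets. *)
Lemma approximate_sandwich p r (e : R) : 0 < e ->
  (forall s, (p s < +oo)%E) -> convex_efun p -> upper_semicontinuous p ->
  (forall s, (r s < +oo)%E) -> convex_efun r -> upper_semicontinuous r ->
  (forall s, (p s <= - r s)%E) ->
  (forall s, extreme_point s -> discrete_state s ->
     exists x, (p s <= (s x)%:E)%E /\ (r s <= (- s x)%:E)%E) ->
  exists x, forall s, (p s < (s x + e)%:E)%E /\ (r s < (- s x + e)%:E)%E.
Proof.
move=> e0 py cp up ry cr ur pr discr.
have shift f s (c : R) : (f s + (- e)%:E < c%:E)%E = (f s < (c + e)%:E)%E.
  by rewrite EFinN lteBlDr// EFinD.
have shifted f : (forall s, (f s < +oo)%E) -> convex_efun f ->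
    upper_semicontinuous f -> [/\ forall s, (f s + (- e)%:E < +oo)%E,
    convex_efun (fun s => f s + (- e)%:E)%E &
    upper_semicontinuous (fun s => f s + (- e)%:E)%E].
  move=> fy cf uf; split.
  - by move=> s; have := fy s; case: (f s) => [c| |]//= _; rewrite ltry.
  - by apply: (convex_efunD (h := fun=> - e)) => // t a b; lra.
  - by apply: (usc_addr (h := fun=> - e)) => //; exact: usc_cst.
have [py' cp' up'] := shifted p py cp up.
have [ry' cr' ur'] := shifted r ry cr ur.
have [|x xP] := strict_sandwich py' cp' up' ry' cr' ur'; last first.
  by exists x => s; have := xP s; rewrite !shift.
move=> s exs; have [ds|nds] := pselect (discrete_state s).
  have [x [px rx]] := discr s exs ds; exists x; rewrite !shift; split.
    by apply: le_lt_trans px _; rewrite lte_fin; lra.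
  by apply: le_lt_trans rx _; rewrite lte_fin; lra.
have [c [d [cd pc rd]]] : exists c d : R,
    [/\ c < d, (p s <= (c + e)%:E)%E & (r s <= (- d + e)%:E)%E].
  have := pr s; have := py s; have := ry s.
  case: (p s) => [y| |]; case: (r s) => [z| |]//= _ _; rewrite ?lee_fin => yz.
  - by exists (y - e), (y + e); rewrite !lee_fin; split; lra.
  - by exists (y - e), (y + e); rewrite !lee_fin leNye; split=> //; lra.
  - by exists (- z - e), (- z + e); rewrite !lee_fin leNye; split=> //; lra.
  - by exists 0, 1; rewrite !leNye; split=> //; lra.
have [x /andP[cx xd]] := nondiscrete_dense nds cd.
exists x; rewrite !shift; split.
  by apply: le_lt_trans pc _; rewrite lte_fin; lra.
by apply: le_lt_trans rd _; rewrite lte_fin; lra.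
Qed.

End Sandwich.

(** * Passage to the limit in the order-unit norm *)

Section UnitNormTheory.
Variables (R : realType) (G : poGroupType) (u : G).
Hypotheses (unp : unperforated G) (uunit : order_unit u).
Implicit Types (s : states R u) (x : G).

(** States determine the norm: a bound on all states becomes an inequality in
    the order of [G] by [states_pos]. *)
Lemma unorm_lt x (c d : R) : 0 <= c -> c < d -> (forall s, `|s x| <= c) ->
  unorm R u x < d.
Proof.
move=> c0 cd xc; have dc : 0 < d - c by rewrite subr_gt0.
(* [n (d - c) > 1] leaves room for a [k] with [n c < k < n d]. *)
pose n := (Num.trunc (d - c)^-1).+1.
have n0 : 0 < n%:R :> R by rewrite ltr0n.
have nd : 1 < n%:R * (d - c) by rewrite -ltr_pdivrMr// div1r truncnS_gt.
pose k := (Num.trunc (n%:R * c)).+1.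
have kgt : n%:R * c < k%:R by exact: truncnS_gt.
have kle : k%:R <= n%:R * c + 1.
  by rewrite -natr1 lerD2r truncn_le mulr_ge0// ltW.
apply: (@le_lt_trans _ _ (k%:R / n%:R)); last first.
  by rewrite ltr_pdivrMr// mulrC; lra.
have ncx s : `|s x *+ n| < k%:R.
  apply: le_lt_trans kgt; rewrite -[s x *+ n]mulr_natl normrM gtr0_norm//.
  by rewrite ler_pM2l.
apply: ge_inf; first by exists 0 => _ [k' [n' [_ _ _ ->]]]; rewrite divr_ge0.
exists k, n; split=> //; rewrite -po_subr_ge0; apply: (states_pos unp uunit) => s;
    have := ncx s; rewrite ltr_norml => /andP[];
    rewrite stateB ?stateN !stateMn state_unit; lra.
Qed.

Lemma state_le_unorm s x : `|s x| <= unorm R u x.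
Proof.
apply: lb_le_inf.
  have [n n0 xn] := uunit.2 x; have [m m0 xm] := uunit.2 (- x).
  have um k : 0 <= u *+ k by apply: po_mulrn_ge0; case: uunit.
  exists ((n + m)%:R / 1%:R), (n + m)%N, 1%N; split=> //; rewrite mulr1n.
    rewrite -po_lerN2 opprK; apply: le_trans xm _.
    by rewrite mulrnDr -[leLHS]add0r po_lerD.
  by apply: le_trans xn _; rewrite mulrnDr -[leLHS]addr0 po_lerD.
move=> _ [k [n [n0 h1 h2 ->]]]; rewrite ler_pdivlMr ?ltr0n//.
have nn : n%:R = `|n%:R : R| by rewrite normr_nat.
rewrite nn -normrM mulr_natr ler_norml.
have := state_le s h1; have := state_le s h2.
by rewrite stateN !stateMn state_unit => -> ->.
Qed.

End UnitNormTheory.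

Section ExactSandwich.
Variables (R : realType) (G : poGroupType) (u : G).
Hypotheses (unp : unperforated G) (itp : interpolation G).
Hypotheses (uunit : order_unit u) (complG : norm_complete R u).
Implicit Types (s : states R u) (x : G) (p r : states R u -> \bar R).

(** The condition at discrete extremal states is used in its full strength here.
    The interval between [max(p, x - e)] and [min(- r, x + e)] contains [s x], or
    else [s x] has left the interval between [p s] and [- r s] through one of
    its ends, which is then finite, a value of [s], and within [e] of
    [s x]. *)
Lemma refine_sandwich p r (e : R) x : 0 < e ->
  (forall s, (p s < +oo)%E) -> convex_efun p -> upper_semicontinuous p ->
  (forall s, (r s < +oo)%E) -> convex_efun r -> upper_semicontinuous r ->
  (forall s, (p s <= - r s)%E) ->
  (forall s, extreme_point s -> discrete_state s ->
    (p s = -oo%E \/ exists y, p s = (s y)%:E) /\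
    (r s = -oo%E \/ exists y, r s = (- s y)%:E)) ->
  (forall s, (p s < (s x + e)%:E)%E /\ (r s < (- s x + e)%:E)%E) ->
  exists y, forall s, [/\ (p s < (s y + e / 2)%:E)%E,
    (r s < (- s y + e / 2)%:E)%E & `|s y - s x| < 2 * e].
Proof.
move=> e0 py cp up ry cr ur pr discr xP.
pose p' s := maxe (p s) (s x - e)%:E.
pose r' s := maxe (r s) (- s x - e)%:E.
have affx : affine_fun (fun s => s x - e).
  by move=> t a b; rewrite state_convE; lra.
have affNx : affine_fun (fun s => - s x - e).
  by move=> t a b; rewrite state_convE; lra.
have uscx y : upper_semicontinuous (fun s : states R u => (s y - e)%:E).
  exact: usc_addr (@eval_usc R G u y) (@usc_cst _ _ (- e)).
have e20 : 0 < e / 2 by lra.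
have [||||||||y yP] := @approximate_sandwich R G u unp itp uunit p' r' (e / 2) e20.
- by move=> s; rewrite gt_max py ltry.
- by apply: convex_efun_max => //; exact: affine_convex_efun.
- exact: usc_max.
- by move=> s; rewrite gt_max ry ltry.
- by apply: convex_efun_max => //; exact: affine_convex_efun.
- apply: usc_max => //.
  rewrite (_ : (fun s : states R u => (- s x - e)%:E) =
    fun s => (s (- x) - e)%:E); first exact: uscx.
  by apply/funext => s; rewrite stateN.
- move=> s; have [px rx] := xP s; rewrite ge_max.
  have rN c : (c <= - r' s)%E = (r s <= - c)%E && ((- s x - e)%:E <= - c)%E.
    by rewrite leeNr ge_max.
  have e1 : - (- s x - e) = s x + e by lra.
  have e2 : - (s x - e) = - s x + e by lra.
  rewrite !rN leeNr pr /= leeNr -!EFinN e1 e2 (ltW px) (ltW rx) lee_fin /=.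
  lra.
- move=> s exs ds; have [hp hr] := discr s exs ds; have [px rx] := xP s.
  have [psx|] := leP (p s) (s x)%:E.
    have [rsx|] := leP (r s) (- s x)%:E.
      by exists x; rewrite !ge_max psx rsx !lee_fin; split; lra.
    case: hr => [->//|[y ry']]; have := pr s; rewrite ry' -EFinN opprK => psy.
    rewrite lte_fin => yx; exists y; rewrite !ge_max psy ry' !lee_fin lexx.
    move: rx; rewrite ry' lte_fin => ?; split; lra.
  case: hp => [->//|[y py']]; have := pr s; rewrite py' leeNr => rsy.
  rewrite lte_fin => xy; exists y; rewrite !ge_max py' rsy !lee_fin lexx.
  move: px; rewrite py' lte_fin => ?; split; lra.
exists y => s; have [] := yP s; rewrite !gt_max => /andP[p1 p2] /andP[r1 r2].
split=> //; rewrite ltr_norml; move: p2 r2; rewrite !lte_fin; lra.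
Qed.

(** Halving the margin at each step displaces the element by at most twice the
    margin, so the successive elements are Cauchy and the margins vanish in the
    limit. *)
Lemma exact_sandwich p r :
  (forall s, (p s < +oo)%E) -> convex_efun p -> upper_semicontinuous p ->
  (forall s, (r s < +oo)%E) -> convex_efun r -> upper_semicontinuous r ->
  (forall s, (p s <= - r s)%E) ->
  (forall s, extreme_point s -> discrete_state s ->
    (p s = -oo%E \/ exists y, p s = (s y)%:E) /\
    (r s = -oo%E \/ exists y, r s = (- s y)%:E)) ->
  exists x, forall s, (p s <= (s x)%:E)%E /\ (r s <= (- s x)%:E)%E.
Proof.
move=> py cp up ry cr ur pr discr.
pose e (n : nat) : R := 2^-1 ^+ n.
have e_gt0 n : 0 < e n by rewrite exprn_gt0.
have eS n : e n.+1 = e n / 2 by rewrite /e exprS mulrC.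
pose ok n x := forall s,
  (p s < (s x + e n)%:E)%E /\ (r s < (- s x + e n)%:E)%E.
have [x0 ok0] : exists x, ok 0%N x.
  apply: (approximate_sandwich unp itp uunit (e_gt0 0%N)) => // s exs ds.
  have [hp hr] := discr s exs ds; have := pr s.
  case: hp => [->|[y py']] prs.
    case: hr => [->|[y ry']]; first by exists 0; rewrite !leNye.
    by exists y; rewrite ry' leNye lexx.
  by exists y; move: prs; rewrite py' lexx leeNr EFinN => ->.
have /choice[nxt nxtP] : forall nx : nat * G, exists y, ok nx.1 nx.2 ->
    forall s, [/\ (p s < (s y + e nx.1.+1)%:E)%E,
      (r s < (- s y + e nx.1.+1)%:E)%E & `|s y - s nx.2| < 2 * e nx.1].
  move=> [n x] /=; have [okx|nok] := pselect (ok n x); last by exists 0.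
  have [y yP] := refine_sandwich (e_gt0 n) py cp up ry cr ur pr discr okx.
  by exists y => _ s; rewrite eS; exact: yP.
pose f := fix f n := if n is k.+1 then nxt (k, f k) else x0.
have okf n : ok n (f n).
  by elim: n => // n IH s; have [] := nxtP (n, f n) IH s.
have fS n s : `|s (f n.+1) - s (f n)| < 2 * e n.
  by have [] := nxtP (n, f n) (okf n) s.
have fD n k s : `|s (f (n + k)%N) - s (f n)| <= 4 * (e n - e (n + k)%N).
  elim: k => [|k IH]; first by rewrite addn0 !subrr normr0 mulr0.
  rewrite addnS eS; have := fS (n + k)%N s.
  move: IH; rewrite !ler_norml ltr_norml => /andP[? ?] /andP[? ?].
  by apply/andP; split; lra.
have fle N n s : (N <= n)%N -> `|s (f n) - s (f N)| <= 4 * e N.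
  move=> Nn; have := fD N (n - N)%N s; rewrite subnKC//.
  by have := e_gt0 n; lra.
have small (d : R) : 0 < d -> exists N, e N < d.
  move=> d0; exists (Num.trunc d^-1).+1; rewrite /e exprVn invf_plt ?posrE ?exprn_gt0//.
  apply: lt_trans (truncnS_gt _) _; rewrite -natrX ltr_nat.
  exact: ltn_expl.
have cf : unorm_cauchy R u f.
  move=> d d0; have [N eN] := small (d / 16) ltac:(lra).
  exists N => m n Nm Nn; apply: (unorm_lt unp uunit (c := 8 * e N)).
  - by have := e_gt0 N; lra.
  - lra.
  move=> s; rewrite stateB; have := fle _ _ s Nm; have := fle _ _ s Nn.
  rewrite !ler_norml => /andP[? ?] /andP[? ?]; apply/andP; split; lra.
have [x fx] := complG cf.
have close (d : R) s : 0 < d -> exists2 n, e n < d & `|s (f n) - s x| < d.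
  move=> d0; have [N eN] := small d d0; have [M MP] := fx d d0.
  exists (maxn N M).
    apply: le_lt_trans eN; rewrite /e ler_wiXn2l ?leq_maxl//; lra.
  rewrite -stateB; apply: le_lt_trans (state_le_unorm uunit s _) _.
  by apply: MP; exact: leq_maxr.
exists x => s; split.
  rewrite leNgt; apply/negP => /ereal_between[c]; rewrite lte_fin => xc cp'.
  have [n en fn] := close ((c - s x) / 2) s ltac:(lra).
  have [/(lt_trans cp') + _] := okf n s; rewrite lte_fin.
  by move: fn; rewrite ltr_norml => /andP[? ?]; lra.
rewrite leNgt; apply/negP => /ereal_between[c]; rewrite lte_fin => xc cp'.
have [n en fn] := close ((c + s x) / 2) s ltac:(lra).
have [_ /(lt_trans cp')] := okf n s; rewrite lte_fin.
by move: fn; rewrite ltr_norml => /andP[? ?]; lra.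
Qed.

End ExactSandwich.

Theorem theorem2p11 (R : realType) (G : poGroupType) (u : G)
    (dimG : dimension_group G) (unit_u : order_unit u)
    (archG : archimedean_group G) (complG : norm_complete R u)
    (p q : states R u -> \bar R)
    (p_ltoo : forall s, (p s < +oo)%E)
    (q_gtNoo : forall s, (-oo < q s)%E)
    (convex_p : convex_efun p) (usc_p : upper_semicontinuous p)
    (concave_q : concave_efun q) (lsc_q : lower_semicontinuous q)
    (le_pq : forall s, (p s <= q s)%E)
    (discr_pq : forall s : states R u, extreme_point s -> discrete_state s ->
       [set p s; q s] `<=` EFin @` range s `|` [set -oo%E; +oo%E]) :
  exists x : G, forall s : states R u,
    (p s <= (phi R u x s)%:E)%E /\ ((phi R u x s)%:E <= q s)%E.
Proof.
have [_ unp itp] := dimG.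
have Nq_ltoo s : (- q s < +oo)%E by rewrite lteNl.
have [|s exs ds|x xP] := exact_sandwich unp itp unit_u complG p_ltoo convex_p
  usc_p Nq_ltoo (concave_efunN q_gtNoo concave_q) (lscN lsc_q).
- by move=> s; rewrite oppeK.
- split.
    have [[_ [y _ <-] yp]|[|]] := discr_pq s exs ds (p s) (or_introl erefl).
    + by right; exists y.
    + by left.
    + by move=> py; have := p_ltoo s; rewrite py.
  have [[_ [y _ <-] yq]|[|]] := discr_pq s exs ds (q s) (or_intror erefl).
  + by right; exists y; rewrite -yq.
  + by move=> qy; have := q_gtNoo s; rewrite qy.
  + by move=> ->; left.
exists x => s; have [px qx] := xP s; split=> //.
by move: qx; rewrite leeNl -EFinN opprK.
Qed.
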